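(* Let $(\mathbf{C},\otimes,\mathbf{1},\sigma)$ be a braided monoidal category, let $\mathrm{Com}(\mathbf{C})$ be the monoidal category of comonoids in $\mathbf{C}$, and let $(X,\Delta_X,\varepsilon_X)$ be a comonoid in $\mathbf{C}$. Then the full monoidal subcategory of $\mathrm{Com}(\mathbf{C})$ whose objects are the tensor powers $X^{\otimes n}$, $n\ge 0$, is cartesian if and only if $X$ is cocommutative and the braiding on $X$ is a symmetry, i.e. $\sigma_{X,X}\circ\sigma_{X,X}=\mathrm{id}_{X\otimes X}$.
   Context: All monoidal categories are assumed strict. A braiding on $\mathbf{C}$ is a natural isomorphism $\sigma_{X,Y}\colon X\otimes Y\to Y\otimes X$ with $\sigma_{X\otimes Y,Z}=(\sigma_{X,Z}\otimes\mathrm{id}_Y)\circ(\mathrm{id}_X\otimes\sigma_{Y,Z})$ and $\sigma_{X,Y\otimes Z}=(\mathrm{id}_Y\otimes\sigma_{X,Z})\circ(\sigma_{X,Y}\otimes\mathrm{id}_Z)$. A comonoid in $\mathbf{C}$ is an object $X$ with morphisms $\Delta_X\colon X\to X\otimes X$ and $\varepsilon_X\colon X\to\mathbf{1}$ such that $(\mathrm{id}_X\otimes\varepsilon_X)\circ\Delta_X=\mathrm{id}_X=(\varepsilon_X\otimes\mathrm{id}_X)\circ\Delta_X$ and $(\Delta_X\otimes\mathrm{id}_X)\circ\Delta_X=(\mathrm{id}_X\otimes\Delta_X)\circ\Delta_X$. It is cocommutative if $\sigma_{X,X}\circ\Delta_X=\Delta_X$. A morphism of comonoids is a morphism $f\colon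 X\to Y$ in $\mathbf{C}$ with $\Delta_Y\circ f=(f\otimes f)\circ\Delta_X$ and $\varepsilon_Y\circ f=\varepsilon_X$. The category $\mathrm{Com}(\mathbf{C})$ of comonoids is monoidal: $X\otimes Y$ carries $\varepsilon_{X\otimes Y}=\varepsilon_X\otimes\varepsilon_Y$ and $\Delta_{X\otimes Y}=(\mathrm{id}_X\otimes\sigma_{X,Y}\otimes\mathrm{id}_Y)\circ(\Delta_X\otimes\Delta_Y)$, and the unit object is $\mathbf{1}$ with identity structure maps. A monoidal category is cartesian if its unit object $\mathbf{1}$ is terminal and, writing $\varepsilon_X\colon X\to\mathbf{1}$ for the unique morphism, for all objects $X,Y$ the object $X\otimes Y$ together with $\pi^1_{XY}=\mathrm{id}_X\otimes\varepsilon_Y\colon X\otimes Y\to X$ and $\pi^2_{XY}=\varepsilon_X\otimes\mathrm{id}_Y\colon X\otimes Y\to Y$ is a categorical product of $X$ and $Y$. *)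

(* Defs.v *)
From Stdlib Require Import ProofIrrelevance.

Declare Scope cat_scope.
Delimit Scope cat_scope with cat.
Open Scope cat_scope.

(** The hom-sets of a category are presented as subsets [hom A B] of one common
    type of arrows, so that equations between arrows whose (co)domains are only
    propositionally equal, as in strict monoidal categories, need no transport.
    A category with hom-sets given as a family of types is obtained as
    [{f | hom A B f}]; conversely, such a family yields a category in the present
    sense, with arrows the triples [(A, B, f)].  The operation [comp] is total,
    but its values on arrows which are not composable are unconstrained and are
    never used; the same applies to [tmor] below on arrows belonging to no
    hom-set. *)
Record category := Category {
  ob : Type;
  arr : Type;
  hom : ob -> ob -> arr -> Prop;
  id : ob -> arr;
  comp : arr -> arr -> arr;
  hom_id : forall A, hom A A (id A);
  hom_comp : forall A B C f g, hom A B f -> hom B C g -> hom A C (comp g f);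
  comp_id_l : forall A B f, hom A B f -> comp (id B) f = f;
  comp_id_r : forall A B f, hom A B f -> comp f (id A) = f;
  comp_assoc : forall A B C D f g h, hom A B f -> hom B C g -> hom C D h ->
    comp h (comp g f) = comp (comp h g) f
}.

Arguments hom {c} A B f.
Arguments id {c} A.
Arguments comp {c} g f.

Notation "g ∘ f" := (comp g f) (at level 45, left associativity) : cat_scope.

Definition is_iso {C : category} (A B : ob C) (f : arr C) : Prop :=
  hom A B f /\ exists g, hom B A g /\ g ∘ f = id A /\ f ∘ g = id B.

Definition is_terminal {C : category} (T : ob C) : Prop :=
  forall A : ob C, exists! f : arr C, hom A T f.

Definition is_product {C : category} (A B P : ob C) (p q : arr C) : Prop :=
  hom P A p /\ hom P B q /\
  forall (Z : ob C) (f g : arr C), hom Z A f -> hom Z B g ->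
    exists! h : arr C, hom Z P h /\ p ∘ h = f /\ q ∘ h = g.

Record strict_monoidal := StrictMonoidal {
  sm_cat :> category;
  unit : ob sm_cat;
  tob : ob sm_cat -> ob sm_cat -> ob sm_cat;
  tmor : arr sm_cat -> arr sm_cat -> arr sm_cat;
  hom_tmor : forall A B A' B' f g, hom A B f -> hom A' B' g ->
    hom (tob A A') (tob B B') (tmor f g);
  tmor_id : forall A B, tmor (id A) (id B) = id (tob A B);
  tmor_comp : forall A B C A' B' C' f g f' g',
    hom A B f -> hom B C g -> hom A' B' f' -> hom B' C' g' ->
    tmor (g ∘ f) (g' ∘ f') = tmor g g' ∘ tmor f f';
  tob_assoc : forall A B C, tob (tob A B) C = tob A (tob B C);
  tob_unit_l : forall A, tob unit A = A;
  tob_unit_r : forall A, tob A unit = A;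
  tmor_assoc : forall A A' B B' C C' f g h,
    hom A A' f -> hom B B' g -> hom C C' h ->
    tmor (tmor f g) h = tmor f (tmor g h);
  tmor_unit_l : forall A B f, hom A B f -> tmor (id unit) f = f;
  tmor_unit_r : forall A B f, hom A B f -> tmor f (id unit) = f
}.

Arguments unit {s}.
Arguments tob {s} A B.
Arguments tmor {s} f g.

Notation "A ⊗₀ B" := (tob A B) (at level 40, left associativity) : cat_scope.
Notation "f ⊗₁ g" := (tmor f g) (at level 40, left associativity) : cat_scope.

Definition cartesian (M : strict_monoidal) : Prop :=
  is_terminal (@unit M) /\
  forall (A B : ob M) (eA eB : arr M), hom A unit eA -> hom B unit eB ->
    is_product A B (A ⊗₀ B) (id A ⊗₁ eB) (eA ⊗₁ id B).

Fixpoint tensor_power {M : strict_monoidal} (A : ob M) (n : nat) : ob M :=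
  match n with
  | O => unit
  | S m => A ⊗₀ tensor_power A m
  end.

Record braided_monoidal := BraidedMonoidal {
  bm_sm :> strict_monoidal;
  braid : ob bm_sm -> ob bm_sm -> arr bm_sm;
  braid_iso : forall A B, is_iso (A ⊗₀ B) (B ⊗₀ A) (braid A B);
  braid_natural : forall A A' B B' f g, hom A A' f -> hom B B' g ->
    braid A' B' ∘ (f ⊗₁ g) = (g ⊗₁ f) ∘ braid A B;
  braid_tensor_l : forall A B C,
    braid (A ⊗₀ B) C = (braid A C ⊗₁ id B) ∘ (id A ⊗₁ braid B C);
  braid_tensor_r : forall A B C,
    braid A (B ⊗₀ C) = (id B ⊗₁ braid A C) ∘ (braid A B ⊗₁ id C)
}.

Arguments braid {b} A B.

Record comonoid (C : braided_monoidal) := Comonoid {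
  carrier :> ob C;
  comul : arr C;
  counit : arr C;
  hom_comul : hom carrier (carrier ⊗₀ carrier) comul;
  hom_counit : hom carrier unit counit;
  counit_r : (id carrier ⊗₁ counit) ∘ comul = id carrier;
  counit_l : (counit ⊗₁ id carrier) ∘ comul = id carrier;
  coassoc : (comul ⊗₁ id carrier) ∘ comul = (id carrier ⊗₁ comul) ∘ comul
}.

Arguments Comonoid {C}.
Arguments carrier {C} c.
Arguments comul {C} c.
Arguments counit {C} c.

Definition cocommutative {C : braided_monoidal} (X : comonoid C) : Prop :=
  braid X X ∘ comul X = comul X.

Definition comonoid_hom {C : braided_monoidal} (X Y : comonoid C) (f : arr C) : Prop :=
  hom (carrier X) (carrier Y) f /\
  comul Y ∘ f = (f ⊗₁ f) ∘ comul X /\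
  counit Y ∘ f = counit X.

Lemma hom_cast {C : category} (A B A' B' : ob C) f :
  hom A' B' f -> A' = A -> B' = B -> hom A B f.
Proof. intros H <- <-; exact H. Qed.

Lemma hom_comp_eq {C : category} (A B B' D : ob C) f g :
  hom A B f -> hom B' D g -> B = B' -> hom A D (g ∘ f).
Proof. intros H H' <-; exact (hom_comp _ _ _ _ _ _ H H'). Qed.

Lemma hom_braid {C : braided_monoidal} (A B : ob C) :
  hom (A ⊗₀ B) (B ⊗₀ A) (braid A B).
Proof. exact (proj1 (braid_iso C A B)). Qed.

Ltac obeq :=
  first [ reflexivity
        | rewrite ?tob_assoc, ?tob_unit_l, ?tob_unit_r; reflexivity ].

Ltac infer :=
  first [ eassumption
        | simple apply hom_id
        | simple apply hom_braid
        | simple apply hom_comul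
        | simple apply hom_counit
        | simple eapply hom_tmor; infer
        | simple eapply hom_comp_eq; [ infer | infer | obeq ] ].

Ltac ty := eapply hom_cast; [ infer | obeq | obeq ].

Section Com.

Context {C : braided_monoidal}.
Implicit Types (A B : ob C) (X Y Z : comonoid C) (f g h : arr C).

Lemma braid_unit_l A : braid unit A = id A.
Proof.
  assert (E : braid unit A = braid unit A ∘ braid unit A).
  { pose proof (braid_tensor_l C unit unit A) as E.
    rewrite tob_unit_l in E.
    erewrite tmor_unit_r, tmor_unit_l in E by ty; exact E. }
  destruct (braid_iso C unit A) as [Hb [k [Hk [kb _]]]].
  rewrite tob_unit_l, tob_unit_r in *.
  assert (E' : k ∘ braid unit A = k ∘ (braid unit A ∘ braid unit A))
    by (rewrite <- E; reflexivity).
  erewrite comp_assoc in E' by ty.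
  rewrite kb in E'.
  erewrite comp_id_l in E' by ty.
  symmetry; exact E'.
Qed.

Lemma braid_unit_r A : braid A unit = id A.
Proof.
  assert (E : braid A unit = braid A unit ∘ braid A unit).
  { pose proof (braid_tensor_r C A unit unit) as E.
    rewrite tob_unit_l in E.
    erewrite tmor_unit_r, tmor_unit_l in E by ty; exact E. }
  destruct (braid_iso C A unit) as [Hb [k [Hk [kb _]]]].
  rewrite tob_unit_l, tob_unit_r in *.
  assert (E' : k ∘ braid A unit = k ∘ (braid A unit ∘ braid A unit))
    by (rewrite <- E; reflexivity).
  erewrite comp_assoc in E' by ty.
  rewrite kb in E'.
  erewrite comp_id_l in E' by ty.
  symmetry; exact E'.
Qed.

Lemma whisker_l A B1 B2 B3 f g : hom B1 B2 f -> hom B2 B3 g ->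
  (id A ⊗₁ g) ∘ (id A ⊗₁ f) = id A ⊗₁ (g ∘ f).
Proof.
  intros Hf Hg.
  erewrite <- tmor_comp by ty.
  erewrite (comp_id_l C A) by ty; reflexivity.
Qed.

Lemma whisker_r A B1 B2 B3 f g : hom B1 B2 f -> hom B2 B3 g ->
  (g ⊗₁ id A) ∘ (f ⊗₁ id A) = (g ∘ f) ⊗₁ id A.
Proof.
  intros Hf Hg.
  erewrite <- tmor_comp by ty.
  erewrite (comp_id_l C A) by ty; reflexivity.
Qed.

Lemma tmor_split_l A A' B B' f g : hom A A' f -> hom B B' g ->
  f ⊗₁ g = (f ⊗₁ id B') ∘ (id A ⊗₁ g).
Proof.
  intros Hf Hg.
  erewrite <- tmor_comp by ty.
  erewrite (comp_id_l C _ _ g), comp_id_r by ty; reflexivity.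
Qed.

Lemma tmor_split_r A A' B B' f g : hom A A' f -> hom B B' g ->
  f ⊗₁ g = (id A' ⊗₁ g) ∘ (f ⊗₁ id B).
Proof.
  intros Hf Hg.
  erewrite <- tmor_comp by ty.
  erewrite (comp_id_l C _ _ f), comp_id_r by ty; reflexivity.
Qed.

Definition tensor_comul (X Y : comonoid C) : arr C :=
  (id (carrier X) ⊗₁ braid X Y ⊗₁ id (carrier Y)) ∘ (comul X ⊗₁ comul Y).

Definition tensor_counit (X Y : comonoid C) : arr C := counit X ⊗₁ counit Y.

Lemma hom_tensor_comul X Y :
  hom (X ⊗₀ Y) ((X ⊗₀ Y) ⊗₀ (X ⊗₀ Y)) (tensor_comul X Y).
Proof. unfold tensor_comul; ty. Qed.

Lemma hom_tensor_counit X Y : hom (X ⊗₀ Y) unit (tensor_counit X Y).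
Proof. unfold tensor_counit; ty. Qed.

Lemma exchange_natural A A' B B' D D' E E' f g h k :
  hom A A' f -> hom B B' g -> hom D D' h -> hom E E' k ->
  (id A' ⊗₁ braid B' D' ⊗₁ id E') ∘ ((f ⊗₁ g) ⊗₁ (h ⊗₁ k))
  = ((f ⊗₁ h) ⊗₁ (g ⊗₁ k)) ∘ (id A ⊗₁ braid B D ⊗₁ id E).
Proof.
  intros Hf Hg Hh Hk.
  replace ((f ⊗₁ g) ⊗₁ (h ⊗₁ k)) with (f ⊗₁ (g ⊗₁ h) ⊗₁ k)
    by (erewrite !tmor_assoc by ty; reflexivity).
  replace ((f ⊗₁ h) ⊗₁ (g ⊗₁ k)) with (f ⊗₁ (h ⊗₁ g) ⊗₁ k)
    by (erewrite !tmor_assoc by ty; reflexivity).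
  erewrite <- (tmor_comp C _ _ _ _ _ _ (f ⊗₁ (g ⊗₁ h))) by ty.
  erewrite <- (tmor_comp C _ _ _ _ _ _ f) by ty.
  erewrite <- (tmor_comp C _ _ _ _ _ _ (id A ⊗₁ braid B D)) by ty.
  erewrite <- (tmor_comp C _ _ _ _ _ _ (id A)) by ty.
  erewrite braid_natural by ty.
  erewrite (comp_id_l C _ _ f), (comp_id_l C _ _ k) by ty.
  erewrite (comp_id_r C _ _ f), (comp_id_r C _ _ k) by ty.
  reflexivity.
Qed.

Lemma tensor_counit_r X Y :
  (id (X ⊗₀ Y) ⊗₁ tensor_counit X Y) ∘ tensor_comul X Y = id (X ⊗₀ Y).
Proof.
  unfold tensor_comul, tensor_counit.
  erewrite comp_assoc by ty.
  rewrite <- tmor_id.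
  erewrite <- exchange_natural by ty.
  rewrite braid_unit_l.
  erewrite <- (comp_assoc C) by ty.
  erewrite <- (tmor_comp C _ _ _ _ _ _ (comul X)) by ty.
  rewrite !counit_r, !tmor_id.
  erewrite comp_id_l by ty. reflexivity.
Qed.

Lemma tensor_counit_l X Y :
  (tensor_counit X Y ⊗₁ id (X ⊗₀ Y)) ∘ tensor_comul X Y = id (X ⊗₀ Y).
Proof.
  unfold tensor_comul, tensor_counit.
  erewrite comp_assoc by ty.
  rewrite <- tmor_id.
  erewrite <- exchange_natural by ty.
  rewrite braid_unit_r.
  erewrite <- (comp_assoc C) by ty.
  erewrite <- (tmor_comp C _ _ _ _ _ _ (comul X)) by ty.
  rewrite !counit_l, !tmor_id.
  erewrite comp_id_l by ty. reflexivity.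
Qed.

Lemma exchange_assoc_inner B D E K :
  (braid B D ⊗₁ id (E ⊗₀ K)) ∘ (id B ⊗₁ braid K (D ⊗₀ E))
  = (id (D ⊗₀ B) ⊗₁ braid K E) ∘ (braid (B ⊗₀ K) D ⊗₁ id E).
Proof.
  rewrite braid_tensor_l, braid_tensor_r.
  erewrite <- whisker_l by ty.
  erewrite <- whisker_r by ty.
  erewrite !comp_assoc by ty.
  f_equal; [|erewrite !tmor_assoc by ty; reflexivity].
  replace (id B ⊗₁ (id D ⊗₁ braid K E)) with (id (B ⊗₀ D) ⊗₁ braid K E)
    by (rewrite <- tmor_id; erewrite !tmor_assoc by ty; reflexivity).
  replace (braid B D ⊗₁ id K ⊗₁ id E) with (braid B D ⊗₁ id (K ⊗₀ E))
    by (rewrite <- tmor_id; erewrite !tmor_assoc by ty; reflexivity).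
  erewrite <- tmor_split_l by ty.
  erewrite <- tmor_split_r by ty.
  reflexivity.
Qed.

Lemma exchange_assoc A B K D E F :
  ((id A ⊗₁ braid B D ⊗₁ id E) ⊗₁ id (K ⊗₀ F))
    ∘ (id (A ⊗₀ B) ⊗₁ braid K (D ⊗₀ E) ⊗₁ id F)
  = (id (A ⊗₀ D) ⊗₁ (id B ⊗₁ braid K E ⊗₁ id F))
    ∘ (id A ⊗₁ braid (B ⊗₀ K) D ⊗₁ id (E ⊗₀ F)).
Proof.
  transitivity (id A ⊗₁ ((braid B D ⊗₁ id (E ⊗₀ K)) ∘ (id B ⊗₁ braid K (D ⊗₀ E)))
                ⊗₁ id F).
  - erewrite <- whisker_l by ty. erewrite <- whisker_r by ty.
    rewrite <- !tmor_id. erewrite !tmor_assoc by ty. reflexivity.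
  - rewrite exchange_assoc_inner.
    erewrite <- whisker_l by ty. erewrite <- whisker_r by ty.
    rewrite <- !tmor_id. erewrite !tmor_assoc by ty. reflexivity.
Qed.

Lemma tensor_coassoc X Y :
  (tensor_comul X Y ⊗₁ id (X ⊗₀ Y)) ∘ tensor_comul X Y
  = (id (X ⊗₀ Y) ⊗₁ tensor_comul X Y) ∘ tensor_comul X Y.
Proof.
  unfold tensor_comul.
  erewrite <- whisker_r by ty. erewrite <- whisker_l by ty.
  rewrite <- !tmor_id.
  erewrite !comp_assoc by ty.
  erewrite <- !(comp_assoc C _ _ _ _ (id _ ⊗₁ braid _ _ ⊗₁ id _)) by ty.
  erewrite <- !exchange_natural by ty.
  erewrite !comp_assoc by ty.
  rewrite !tmor_id, exchange_assoc, <- !tmor_id.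
  erewrite <- !(comp_assoc C _ _ _ _ (comul X ⊗₁ comul Y)) by ty.
  erewrite <- !(tmor_comp C _ _ _ _ _ _ (comul X)) by ty.
  rewrite !coassoc. reflexivity.
Qed.

Lemma braid_triple_inner A B D :
  (id B ⊗₁ braid (A ⊗₀ B) D) ∘ (braid A B ⊗₁ id (B ⊗₀ D))
  = (braid A (B ⊗₀ D) ⊗₁ id B) ∘ (id (A ⊗₀ B) ⊗₁ braid B D).
Proof.
  rewrite braid_tensor_l, braid_tensor_r.
  erewrite <- whisker_l by ty.
  erewrite <- whisker_r by ty.
  erewrite <- !(comp_assoc C) by ty.
  f_equal; [erewrite tmor_assoc by ty; reflexivity|].
  replace (id B ⊗₁ (id A ⊗₁ braid B D)) with (id (B ⊗₀ A) ⊗₁ braid B D)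
    by (rewrite <- tmor_id; erewrite !tmor_assoc by ty; reflexivity).
  replace (braid A B ⊗₁ id D ⊗₁ id B) with (braid A B ⊗₁ id (D ⊗₀ B))
    by (rewrite <- tmor_id; erewrite !tmor_assoc by ty; reflexivity).
  erewrite <- tmor_split_l by ty.
  erewrite <- tmor_split_r by ty.
  reflexivity.
Qed.

Lemma braid_triple A B D :
  (id (A ⊗₀ B) ⊗₁ braid (A ⊗₀ B) D ⊗₁ id D)
    ∘ ((id A ⊗₁ braid A B ⊗₁ id B) ⊗₁ id (D ⊗₀ D))
  = (id A ⊗₁ braid A (B ⊗₀ D) ⊗₁ id (B ⊗₀ D))
    ∘ (id (A ⊗₀ A) ⊗₁ (id B ⊗₁ braid B D ⊗₁ id D)).
Proof.
  transitivity (id A ⊗₁ ((id B ⊗₁ braid (A ⊗₀ B) D) ∘ (braid A B ⊗₁ id (B ⊗₀ D)))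
                ⊗₁ id D).
  - erewrite <- whisker_l by ty. erewrite <- whisker_r by ty.
    rewrite <- !tmor_id. erewrite !tmor_assoc by ty. reflexivity.
  - rewrite braid_triple_inner.
    erewrite <- whisker_l by ty. erewrite <- whisker_r by ty.
    rewrite <- !tmor_id. erewrite !tmor_assoc by ty. reflexivity.
Qed.

Lemma tmor_precomp_l A B D A' B' f g h :
  hom A B f -> hom B D g -> hom A' B' h ->
  (g ∘ f) ⊗₁ h = (g ⊗₁ id B') ∘ (f ⊗₁ h).
Proof.
  intros Hf Hg Hh. erewrite <- tmor_comp by ty.
  erewrite (comp_id_l C _ _ h) by ty. reflexivity.
Qed.

Lemma tmor_precomp_r A B D A' B' f g h :
  hom A B f -> hom B D g -> hom A' B' h ->
  h ⊗₁ (g ∘ f) = (id B' ⊗₁ g) ∘ (h ⊗₁ f).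
Proof.
  intros Hf Hg Hh. erewrite <- tmor_comp by ty.
  erewrite (comp_id_l C _ _ h) by ty. reflexivity.
Qed.

Definition tensor_comonoid X Y : comonoid C := {|
  carrier := X ⊗₀ Y;
  comul := tensor_comul X Y;
  counit := tensor_counit X Y;
  hom_comul := hom_tensor_comul X Y;
  hom_counit := hom_tensor_counit X Y;
  counit_r := tensor_counit_r X Y;
  counit_l := tensor_counit_l X Y;
  coassoc := tensor_coassoc X Y
|}.

Lemma hom_unit_comul : hom unit (unit ⊗₀ unit) (@id C unit).
Proof. ty. Qed.

Lemma unit_counit : (id unit ⊗₁ id unit) ∘ id unit = @id C unit.
Proof. rewrite tmor_id, tob_unit_l. erewrite comp_id_l by ty. reflexivity. Qed.

Definition unit_comonoid : comonoid C := {|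
  carrier := unit;
  comul := id unit;
  counit := id unit;
  hom_comul := hom_unit_comul;
  hom_counit := hom_id C unit;
  counit_r := unit_counit;
  counit_l := unit_counit;
  coassoc := eq_refl
|}.

Lemma comonoid_eq X Y : carrier X = carrier Y -> comul X = comul Y ->
  counit X = counit Y -> X = Y.
Proof.
  destruct X, Y; cbn; intros; subst; f_equal; apply proof_irrelevance.
Qed.

Lemma comonoid_hom_id X : comonoid_hom X X (id (carrier X)).
Proof.
  repeat split.
  - ty.
  - rewrite tmor_id. erewrite comp_id_l, comp_id_r by ty. reflexivity.
  - erewrite comp_id_r by ty. reflexivity.
Qed.

Lemma comonoid_hom_comp X Y Z f g :
  comonoid_hom X Y f -> comonoid_hom Y Z g -> comonoid_hom X Z (g ∘ f).
Proof.
  intros [Hf [Df Ef]] [Hg [Dg Eg]]; repeat split.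
  - ty.
  - erewrite tmor_comp by ty.
    erewrite comp_assoc by ty. rewrite Dg.
    erewrite <- !(comp_assoc C) by ty. rewrite Df. reflexivity.
  - erewrite comp_assoc by ty. rewrite Eg. exact Ef.
Qed.

Lemma comonoid_hom_tensor X X' Y Y' f g :
  comonoid_hom X Y f -> comonoid_hom X' Y' g ->
  comonoid_hom (tensor_comonoid X X') (tensor_comonoid Y Y') (f ⊗₁ g).
Proof.
  intros [Hf [Df Ef]] [Hg [Dg Eg]]; repeat split; cbn.
  - ty.
  - unfold tensor_comul.
    erewrite <- (comp_assoc C _ _ _ _ (f ⊗₁ g)) by ty.
    erewrite <- (tmor_comp C _ _ _ _ _ _ f) by ty.
    rewrite Df, Dg.
    erewrite (tmor_comp C _ _ _ _ _ _ (comul X)) by ty.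
    erewrite !comp_assoc by ty.
    erewrite exchange_natural by ty. reflexivity.
  - unfold tensor_counit.
    erewrite <- tmor_comp by ty. rewrite Ef, Eg. reflexivity.
Qed.

Lemma tensor_comonoid_assoc X Y Z :
  tensor_comonoid (tensor_comonoid X Y) Z = tensor_comonoid X (tensor_comonoid Y Z).
Proof.
  apply comonoid_eq; cbn.
  - apply tob_assoc.
  - unfold tensor_comul; cbn; unfold tensor_comul.
    erewrite tmor_precomp_l by ty. erewrite tmor_precomp_r by ty.
    erewrite !comp_assoc by ty.
    rewrite braid_triple.
    erewrite !tmor_assoc by ty. reflexivity.
  - unfold tensor_counit; cbn; unfold tensor_counit.
    erewrite tmor_assoc by ty. reflexivity.
Qed.

Lemma tensor_comonoid_unit_l X : tensor_comonoid unit_comonoid X = X.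
Proof.
  apply comonoid_eq; cbn.
  - apply tob_unit_l.
  - unfold tensor_comul; cbn. rewrite braid_unit_l, !tmor_id.
    erewrite tmor_unit_l by ty. erewrite comp_id_l by ty. reflexivity.
  - unfold tensor_counit; cbn. erewrite tmor_unit_l by ty. reflexivity.
Qed.

Lemma tensor_comonoid_unit_r X : tensor_comonoid X unit_comonoid = X.
Proof.
  apply comonoid_eq; cbn.
  - apply tob_unit_r.
  - unfold tensor_comul; cbn. rewrite braid_unit_r, !tmor_id.
    erewrite tmor_unit_r by ty. erewrite comp_id_l by ty. reflexivity.
  - unfold tensor_counit; cbn. erewrite tmor_unit_r by ty. reflexivity.
Qed.

End Com.

Definition Com_cat (C : braided_monoidal) : category.
Proof.
  refine {|
    ob := comonoid C;
    arr := arr C;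
    hom := comonoid_hom;
    id := fun X => id (carrier X);
    comp := comp
  |}.
  - exact comonoid_hom_id.
  - exact comonoid_hom_comp.
  - intros X Y f [Hf _]. exact (comp_id_l C _ _ _ Hf).
  - intros X Y f [Hf _]. exact (comp_id_r C _ _ _ Hf).
  - intros X Y Z W f g h [Hf _] [Hg _] [Hh _].
    exact (comp_assoc C _ _ _ _ _ _ _ Hf Hg Hh).
Defined.

Definition Com (C : braided_monoidal) : strict_monoidal.
Proof.
  refine {|
    sm_cat := Com_cat C;
    unit := unit_comonoid : ob (Com_cat C);
    tob := tensor_comonoid : ob (Com_cat C) -> ob (Com_cat C) -> ob (Com_cat C);
    tmor := @tmor C : arr (Com_cat C) -> arr (Com_cat C) -> arr (Com_cat C)
  |}.
  - intros; cbn; apply comonoid_hom_tensor; assumption.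
  - intros; cbn; apply tmor_id.
  - intros A B D A' B' D' f g f' g' [Hf _] [Hg _] [Hf' _] [Hg' _].
    exact (tmor_comp C _ _ _ _ _ _ _ _ _ _ Hf Hg Hf' Hg').
  - exact tensor_comonoid_assoc.
  - exact tensor_comonoid_unit_l.
  - exact tensor_comonoid_unit_r.
  - intros A A' B B' D D' f g h [Hf _] [Hg _] [Hh _].
    exact (tmor_assoc C _ _ _ _ _ _ _ _ _ Hf Hg Hh).
  - intros A B f [Hf _]. exact (tmor_unit_l C _ _ _ Hf).
  - intros A B f [Hf _]. exact (tmor_unit_r C _ _ _ Hf).
Defined.

Definition full_subcat (M : category) (P : ob M -> Prop) : category.
Proof.
  refine {|
    ob := {A : ob M | P A};
    arr := arr M;
    hom := fun A B f => hom (proj1_sig A) (proj1_sig B) f;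
    id := fun A => id (proj1_sig A);
    comp := comp
  |}.
  - intros A. apply hom_id.
  - intros A B D f g. apply hom_comp.
  - intros A B f. apply comp_id_l.
  - intros A B f. apply comp_id_r.
  - intros A B D E f g h. apply comp_assoc.
Defined.

Definition full_monoidal_subcat (M : strict_monoidal) (P : ob M -> Prop)
  (P_unit : P unit) (P_tensor : forall A B, P A -> P B -> P (A ⊗₀ B)) :
  strict_monoidal.
Proof.
  refine {|
    sm_cat := full_subcat M P;
    unit := exist _ unit P_unit : ob (full_subcat M P);
    tob := (fun A B => exist _ (proj1_sig A ⊗₀ proj1_sig B)
                         (P_tensor _ _ (proj2_sig A) (proj2_sig B)))
           : ob (full_subcat M P) -> ob (full_subcat M P) -> ob (full_subcat M P);
    tmor := @tmor M : arr (full_subcat M P) -> arr (full_subcat M P) ->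
                      arr (full_subcat M P)
  |}.
  - intros A B A' B' f g. apply hom_tmor.
  - intros A B. apply tmor_id.
  - intros A B D A' B' D' f g f' g'. apply tmor_comp.
  - intros A B D. apply subset_eq_compat, tob_assoc.
  - intros [A PA]. apply subset_eq_compat, tob_unit_l.
  - intros [A PA]. apply subset_eq_compat, tob_unit_r.
  - intros A A' B B' D D' f g h. apply tmor_assoc.
  - intros A B f. apply tmor_unit_l.
  - intros A B f. apply tmor_unit_r.
Defined.

Definition is_tensor_power {M : strict_monoidal} (X A : ob M) : Prop :=
  exists n : nat, A = tensor_power X n.

Lemma is_tensor_power_unit {M : strict_monoidal} (X : ob M) : is_tensor_power X unit.
Proof. exists O. reflexivity. Qed.

Lemma tensor_power_add {M : strict_monoidal} (X : ob M) m n :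
  tensor_power X m ⊗₀ tensor_power X n = tensor_power X (m + n).
Proof.
  induction m as [|m IH]; cbn.
  - apply tob_unit_l.
  - rewrite tob_assoc, IH. reflexivity.
Qed.

Lemma is_tensor_power_tensor {M : strict_monoidal} (X A B : ob M) :
  is_tensor_power X A -> is_tensor_power X B -> is_tensor_power X (A ⊗₀ B).
Proof.
  intros [m ->] [n ->]. exists (m + n). apply tensor_power_add.
Qed.

Definition tensor_powers (M : strict_monoidal) (X : ob M) : strict_monoidal :=
  full_monoidal_subcat M (is_tensor_power X)
    (is_tensor_power_unit X) (is_tensor_power_tensor X).

(* Main.v *)
Require Import Defs.

(** For any comonoid [Z] and comonoid morphism [h : Z -> X ⊗ Y], the counits give
    [h = (π1 h ⊗ π2 h) ∘ Δ_Z], so pairings in [Com C] are unique and can only be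
    [(f ⊗ g) ∘ Δ_Z].  They all exist as soon as every [Δ_Z] is a comonoid morphism,
    and the pairing of two identities forces this; by an Eckmann-Hilton argument
    [Δ_Z] is a comonoid morphism iff [Z] is cocommutative.  Finally, erasing
    the outer tensor factors of [Δ_(X ⊗ Y)] gives [σ_(X,Y)] and erasing the inner
    ones gives the identity, so that cocommutativity of [X ⊗ Y] contains
    [σ_(Y,X) ∘ σ_(X,Y) = id]; conversely this equation and cocommutativity of [X]
    and [Y] imply that of [X ⊗ Y]. *)

Section Comonoids.

Context {C : braided_monoidal}.
Implicit Types (A B D : ob C) (X Y Z : comonoid C) (f g h : arr C).

(** Naturality moves the inner counits below the braiding, which becomes [braid unit unit], an
    identity; the counit laws do the rest. *)
Lemma tensor_comul_inner_counit X Y :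
  ((id X ⊗₁ counit Y) ⊗₁ (counit X ⊗₁ id Y)) ∘ tensor_comul X Y = id (X ⊗₀ Y).
Proof.
  unfold tensor_comul.
  erewrite comp_assoc by ty.
  erewrite <- exchange_natural by ty.
  rewrite braid_unit_l.
  erewrite <- (comp_assoc C) by ty.
  erewrite <- (tmor_comp C _ _ _ _ _ _ (comul X)) by ty.
  rewrite counit_r, counit_l, !tmor_id, tob_unit_r.
  erewrite comp_id_l by ty. reflexivity.
Qed.

(** Here the counits miss the strands that cross, so the braiding survives. *)
Lemma tensor_comul_outer_counit X Y :
  ((counit X ⊗₁ id Y) ⊗₁ (id X ⊗₁ counit Y)) ∘ tensor_comul X Y = braid X Y.
Proof.
  unfold tensor_comul.
  erewrite comp_assoc by ty.
  erewrite <- exchange_natural by ty.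
  erewrite tmor_unit_r by ty. erewrite tmor_unit_l by ty.
  erewrite <- (comp_assoc C) by ty.
  erewrite <- (tmor_comp C _ _ _ _ _ _ (comul X)) by ty.
  rewrite counit_r, counit_l, !tmor_id.
  erewrite comp_id_r by ty. reflexivity.
Qed.

Lemma comonoid_hom_pairing X Y Z h : comonoid_hom Z (tensor_comonoid X Y) h ->
  h = (((id X ⊗₁ counit Y) ∘ h) ⊗₁ ((counit X ⊗₁ id Y) ∘ h)) ∘ comul Z.
Proof.
  intros [Hh [Dh _]]. cbn in Hh, Dh.
  pose proof (hom_tensor_comul X Y).
  erewrite tmor_comp by ty.
  erewrite <- comp_assoc by ty.
  rewrite <- Dh.
  erewrite comp_assoc by ty.
  rewrite tensor_comul_inner_counit.
  erewrite comp_id_l by ty. reflexivity.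
Qed.

(** Coassociativity rebrackets the fourfold comultiplication so that a single [comul Z] feeds the
    two middle strands, where [tensor_comul Z Z] braids them. *)
Lemma tmor_comul_comul Z :
  (comul Z ⊗₁ comul Z) ∘ comul Z
  = (id Z ⊗₁ comul Z ⊗₁ id Z) ∘ ((id Z ⊗₁ comul Z) ∘ comul Z).
Proof.
  erewrite (tmor_split_l _ _ _ _ (comul Z)) by ty.
  erewrite <- comp_assoc by ty.
  rewrite <- coassoc.
  erewrite comp_assoc by ty.
  rewrite <- tmor_id.
  erewrite comp_assoc by ty.
  erewrite <- (tmor_assoc C _ _ _ _ _ _ (comul Z)) by ty.
  erewrite !whisker_r by ty.
  rewrite coassoc. reflexivity.
Qed.

Lemma comul_comonoid_hom Z :
  cocommutative Z -> comonoid_hom Z (tensor_comonoid Z Z) (comul Z).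
Proof.
  intros H; repeat split; cbn.
  - ty.
  - unfold tensor_comul.
    erewrite <- comp_assoc by ty.
    rewrite tmor_comul_comul.
    erewrite comp_assoc by ty.
    erewrite whisker_r by ty. erewrite whisker_l by ty.
    rewrite H. reflexivity.
  - unfold tensor_counit.
    erewrite tmor_split_l by ty.
    erewrite <- comp_assoc by ty.
    rewrite counit_r.
    erewrite comp_id_r by ty.
    erewrite tmor_unit_r by ty. reflexivity.
Qed.

(** Erasing the outer factors in the comultiplication equation leaves [braid Z Z ∘ comul Z] on one
    side and [comul Z] on the other. *)
Lemma cocommutative_of_comul_hom Z :
  comonoid_hom Z (tensor_comonoid Z Z) (comul Z) -> cocommutative Z.
Proof.
  intros [_ [D _]]. cbn in D. unfold cocommutative.
  pose proof (hom_tensor_comul Z Z).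
  rewrite <- tensor_comul_outer_counit.
  erewrite <- comp_assoc by ty.
  rewrite D.
  erewrite comp_assoc by ty.
  erewrite <- tmor_comp by ty.
  rewrite counit_l, counit_r, tmor_id.
  erewrite comp_id_l by ty. reflexivity.
Qed.

Lemma braid_involutive_of_cocommutative X Y :
  cocommutative (tensor_comonoid X Y) -> braid Y X ∘ braid X Y = id (X ⊗₀ Y).
Proof.
  unfold cocommutative; cbn; intros H.
  pose proof (hom_tensor_comul X Y).
  rewrite <- (tensor_comul_inner_counit X Y), <- H.
  erewrite comp_assoc by ty.
  (* Sliding the counits through the large braiding turns inner erasure into outer erasure followed
     by [braid Y X]. *)
  replace (((id X ⊗₁ counit Y) ⊗₁ (counit X ⊗₁ id Y)) ∘ braid (X ⊗₀ Y) (X ⊗₀ Y))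
    with (braid Y X ∘ ((counit X ⊗₁ id Y) ⊗₁ (id X ⊗₁ counit Y))).
  - erewrite <- comp_assoc by ty.
    rewrite tensor_comul_outer_counit. reflexivity.
  - erewrite <- braid_natural by ty.
    rewrite tob_unit_l, tob_unit_r. reflexivity.
Qed.

(** After both hexagon rules the two crossings of [B] and [D] are adjacent; once they cancel, those
    of [A] and [D] meet. *)
Lemma braid_tensor_involutive A B D :
  braid A D ∘ braid D A = id (D ⊗₀ A) -> braid B D ∘ braid D B = id (D ⊗₀ B) ->
  braid (A ⊗₀ B) D ∘ braid D (A ⊗₀ B) = id (D ⊗₀ (A ⊗₀ B)).
Proof.
  intros HA HB.
  rewrite braid_tensor_l, braid_tensor_r.
  erewrite <- comp_assoc by ty.
  erewrite (comp_assoc C _ _ _ _ (braid D A ⊗₁ id B)) by ty.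
  erewrite whisker_l by ty.
  rewrite HB, tmor_id.
  erewrite comp_id_l by ty.
  erewrite whisker_r by ty.
  rewrite HA, tmor_id, tob_assoc. reflexivity.
Qed.

(** Ordered for use after [tensor_comul]: the first crossing undoes its exchange under symmetry,
    cocommutativity absorbs the middle pair, and the last crossing restores the exchange. *)
Lemma braid_tensor_tensor A B :
  braid (A ⊗₀ B) (A ⊗₀ B)
  = (id A ⊗₁ braid A B ⊗₁ id B) ∘
    ((braid A A ⊗₁ braid B B) ∘ (id A ⊗₁ braid B A ⊗₁ id B)).
Proof.
  rewrite braid_tensor_l, !braid_tensor_r.
  erewrite <- whisker_l by ty. erewrite <- whisker_r by ty.
  erewrite (tmor_split_l _ _ _ _ (braid A A) (braid B B)) by ty.
  rewrite <- !tmor_id.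
  erewrite !tmor_assoc by ty.
  erewrite !comp_assoc by ty. reflexivity.
Qed.

Lemma tensor_cocommutative X Y : cocommutative X -> cocommutative Y ->
  braid Y X ∘ braid X Y = id (X ⊗₀ Y) -> cocommutative (tensor_comonoid X Y).
Proof.
  unfold cocommutative; cbn; intros HX HY H.
  rewrite braid_tensor_tensor. unfold tensor_comul.
  erewrite <- !comp_assoc by ty.
  erewrite (comp_assoc C _ _ _ _ (comul X ⊗₁ comul Y)) by ty.
  erewrite whisker_r by ty. erewrite whisker_l by ty.
  rewrite H, !tmor_id.
  erewrite comp_id_l by ty.
  erewrite <- tmor_comp by ty.
  rewrite HX, HY. reflexivity.
Qed.

Lemma comonoid_product X Y Z f g : cocommutative Z ->
  comonoid_hom Z X f -> comonoid_hom Z Y g ->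
  exists! h, comonoid_hom Z (tensor_comonoid X Y) h /\
    (id X ⊗₁ counit Y) ∘ h = f /\ (counit X ⊗₁ id Y) ∘ h = g.
Proof.
  intros HZ Hf Hg.
  exists ((f ⊗₁ g) ∘ comul Z); split.
  - split; [|destruct Hf as [Hf [_ Ef]], Hg as [Hg [_ Eg]]; split].
    + eapply comonoid_hom_comp; [apply comul_comonoid_hom, HZ|].
      apply comonoid_hom_tensor; assumption.
    + erewrite comp_assoc by ty.
      erewrite <- tmor_comp by ty.
      rewrite Eg. erewrite (comp_id_l C _ _ f) by ty.
      erewrite tmor_split_l by ty.
      erewrite <- comp_assoc by ty.
      rewrite counit_r. erewrite tmor_unit_r by ty.
      erewrite comp_id_r by ty. reflexivity.
    + erewrite comp_assoc by ty.
      erewrite <- tmor_comp by ty.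
      rewrite Ef. erewrite (comp_id_l C _ _ g) by ty.
      erewrite tmor_split_r by ty.
      erewrite <- comp_assoc by ty.
      rewrite counit_l. erewrite tmor_unit_l by ty.
      erewrite comp_id_r by ty. reflexivity.
  - intros h [Hh [<- <-]]. symmetry. apply comonoid_hom_pairing, Hh.
Qed.

Lemma cocommutative_of_diagonal Z h : comonoid_hom Z (tensor_comonoid Z Z) h ->
  (id Z ⊗₁ counit Z) ∘ h = id Z -> (counit Z ⊗₁ id Z) ∘ h = id Z ->
  cocommutative Z.
Proof.
  intros Hh E1 E2. apply cocommutative_of_comul_hom.
  replace (comul Z) with h; [exact Hh|].
  rewrite (comonoid_hom_pairing _ _ _ _ Hh), E1, E2, tmor_id.
  erewrite comp_id_l by ty. reflexivity.
Qed.

(** This gives terminality of the unit and identifies the maps [eA], [eB] in [cartesian] with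
    counits. *)
Lemma comonoid_hom_unit Z f : comonoid_hom Z unit_comonoid f <-> f = counit Z.
Proof.
  split.
  - intros [Hf [_ E]]. cbn in Hf, E. rewrite <- E.
    erewrite comp_id_l by ty. reflexivity.
  - intros ->. repeat split; cbn.
    + ty.
    + erewrite comp_id_l by ty.
      erewrite tmor_split_l by ty. erewrite tmor_unit_r by ty.
      erewrite <- comp_assoc by ty.
      rewrite counit_r. erewrite comp_id_r by ty. reflexivity.
    + erewrite comp_id_l by ty. reflexivity.
Qed.

Lemma unit_cocommutative : cocommutative (@unit_comonoid C).
Proof.
  unfold cocommutative; cbn.
  rewrite braid_unit_l. erewrite comp_id_l by ty. reflexivity.
Qed.

Lemma tensor_power_cocommutative X n : cocommutative X ->
  braid X X ∘ braid X X = id (X ⊗₀ X) ->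
  cocommutative (tensor_power (X : ob (Com C)) n).
Proof.
  intros HX S.
  (* The induction step tensors [X] with a power, so the braiding between these two must be known to
     be involutive as well. *)
  enough (H : cocommutative (tensor_power (X : ob (Com C)) n) /\
    braid (carrier (tensor_power (X : ob (Com C)) n)) X
      ∘ braid X (carrier (tensor_power (X : ob (Com C)) n))
    = id (X ⊗₀ carrier (tensor_power (X : ob (Com C)) n))) by apply H.
  induction n as [|n [IHc IHs]]; cbn; split.
  - apply unit_cocommutative.
  - rewrite braid_unit_l, braid_unit_r, tob_unit_r.
    erewrite comp_id_l by ty. reflexivity.
  - apply tensor_cocommutative; assumption.
  - apply braid_tensor_involutive; assumption.
Qed.

End Comonoids.

Theorem theorem1p1 (C : braided_monoidal) (X : comonoid C) :
  cartesian (tensor_powers (Com C) X) <->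
  cocommutative X /\ braid X X ∘ braid X X = id (X ⊗₀ X).
Proof.
  split.
  - intros [_ Hprod].
    assert (Hc : forall Z : comonoid C,
              is_tensor_power (M := Com C) X Z -> cocommutative Z).
    { intros Z PZ.
      pose (Z' := exist _ Z PZ : ob (tensor_powers (Com C) X)).
      assert (Hc : comonoid_hom Z unit_comonoid (counit Z))
        by (apply comonoid_hom_unit; reflexivity).
      (* The diagonal of [Z] comes from the product of [Z] with itself. *)
      destruct (Hprod Z' Z' (counit Z) (counit Z) Hc Hc) as [_ [_ H]].
      destruct (H Z' _ _ (comonoid_hom_id Z) (comonoid_hom_id Z))
        as [h [[Hh [E1 E2]] _]].
      exact (cocommutative_of_diagonal Z h Hh E1 E2). }
    assert (PX : is_tensor_power (M := Com C) X X)
      by (exists 1; symmetry; apply (tob_unit_r (Com C))).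
    split; [exact (Hc X PX)|].
    (* Symmetry is read off from cocommutativity of the tensor square. *)
    apply braid_involutive_of_cocommutative, Hc.
    exact (is_tensor_power_tensor (M := Com C) X X X PX PX).
  - intros [HX S].
    assert (Hc : forall Z : comonoid C,
              is_tensor_power (M := Com C) X Z -> cocommutative Z)
      by (intros Z [n ->]; apply tensor_power_cocommutative; assumption).
    split.
    + intros [Z PZ]. exists (counit Z). split.
      * apply comonoid_hom_unit. reflexivity.
      * intros f Hf. symmetry. apply comonoid_hom_unit, Hf.
    + intros [A PA] [B PB] eA eB HA HB.
      apply comonoid_hom_unit in HA, HB. cbn in HA, HB. subst eA eB.
      assert (HA : comonoid_hom A unit_comonoid (counit A))
        by (apply comonoid_hom_unit; reflexivity).
      assert (HB : comonoid_hom B unit_comonoid (counit B))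
        by (apply comonoid_hom_unit; reflexivity).
      split; [|split].
      * pose proof (comonoid_hom_tensor _ _ _ _ _ _ (comonoid_hom_id A) HB) as H.
        (* The target is [A] tensored with the unit, which equals [A] as a comonoid, not merely as
           an object. *)
        rewrite tensor_comonoid_unit_r in H. exact H.
      * pose proof (comonoid_hom_tensor _ _ _ _ _ _ HA (comonoid_hom_id B)) as H.
        rewrite tensor_comonoid_unit_l in H. exact H.
      * intros [Z PZ] f g Hf Hg.
        exact (comonoid_product A B Z f g (Hc Z PZ) Hf Hg).
Qed.
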